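(* Let $N$ be a positive integer, let $a,t,q\in\mathbb{C}$ with $|q|<1$ and $|t|<1$, and let $g(x)=\sum_{n=0}^{\infty}g_nx^n$ be a power series. Then \[ \sum_{n=0}^{\infty}g_{n}\left[\frac{(aq^N)_{n}}{(tq^N)_{n}}\frac{(t)_{n}}{(a)_{n}} -\frac{(t)_{N}}{(a)_{N}}\right] = \frac{(t)_{N}}{(a)_{N}}\sum_{n=1}^{\infty}\left\{\sum_{k=0}^{n}\begin{bmatrix} n\\k\end{bmatrix}\left(\frac{aq^{N}}{t}\right)^k(q^{-N})_{k}(q^{N})_{n-k}\right\}\frac{g(q^n)}{(q)_n}t^n . \]
   Context: For $x\in\mathbb{C}$ and $n\ge 0$, $(x)_n=(x;q)_n=\prod_{j=0}^{n-1}(1-xq^j)$ (with $(x)_0=1$) and $(x)_\infty=\prod_{j=0}^{\infty}(1-xq^j)$. The Gaussian binomial coefficient is $\begin{bmatrix} n\\k\end{bmatrix}=\frac{(q)_n}{(q)_{n-k}(q)_k}$ for $0\le k\le n$. *)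

(* Defs.v *)
From Stdlib Require Import Reals.
From Coquelicot Require Import Coquelicot.

Open Scope C_scope.

Fixpoint qpoch (x q : C) (n : nat) : C :=
  match n with
  | O => 1
  | S m => qpoch x q m * (1 - x * q ^ m)
  end.

(* Meaningful only for k <= n, since the subtraction on nat is truncated. *)
Definition qbinom (q : C) (n k : nat) : C :=
  qpoch q q n / (qpoch q q (n - k) * qpoch q q k).

(* Main.v *)
(** With s = a/t, the inner sum divided by (q)_n is the coefficient c_n of z^n in
    F(z) = (sz)_N / (z)_N, by the two finite cases of the q-binomial theorem
    (numerator coefficients (q^{-N})_k (s q^N)^k / (q)_k, denominator
    coefficients (q^N)_j / (q)_j).  This expansion is obtained one linear factor
    at a time: multiplying or dividing a power series by 1 - sigma z is a
    two-term recurrence on coefficients.  On the other side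
    (aq^N)_n (t)_n / ((tq^N)_n (a)_n) = (t)_N / (a)_N * F(tq^n), so the theorem
    says that the double series g_n c_m t^m q^{nm} (m >= 1) may be summed in
    either order. *)
Require Import Defs.
From Stdlib Require Import Reals Lra Lia.
From Coquelicot Require Import Coquelicot.

Open Scope C_scope.

(** * Convergence and comparison of complex series *)

Notation is_Cseries := (is_series (K := C_AbsRing) (V := C_NormedModule)).
Notation Csum := (sum_n (G := C_AbelianGroup)).

Lemma is_Cseries_plus (a b : nat -> C) (la lb : C) :
  is_Cseries a la -> is_Cseries b lb ->
  is_Cseries (fun n => a n + b n) (la + lb).
Proof. exact (is_series_plus (V := C_NormedModule) a b la lb). Qed.

Lemma is_Cseries_scal (c : C) (a : nat -> C) (l : C) :
  is_Cseries a l -> is_Cseries (fun n => c * a n) (c * l).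
Proof. exact (is_series_scal (V := C_NormedModule) c a l). Qed.

Lemma is_Cseries_congr (a b : nat -> C) (l l' : C) :
  is_Cseries a l -> (forall n, a n = b n) -> l = l' -> is_Cseries b l'.
Proof. intros Ha Hab <-. exact (is_series_ext _ _ _ Hab Ha). Qed.

Lemma is_Cseries_cons (a : nat -> C) (l : C) :
  is_Cseries (fun n => a (S n)) l -> is_Cseries a (a O + l).
Proof.
  intros H. apply (is_series_decr_1 (V := C_NormedModule)).
  apply (is_Cseries_congr _ _ _ _ H); [reflexivity|].
  change (l = a O + l + - a O). ring.
Qed.

Lemma is_Cseries_tl (a : nat -> C) (l : C) :
  is_Cseries a l -> is_Cseries (fun n => a (S n)) (l - a O).
Proof.
  intros H. apply (is_series_incr_1 (V := C_NormedModule)).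
  apply (is_Cseries_congr _ _ _ _ H); [reflexivity|].
  change (l = l - a O + a O). ring.
Qed.

(** Real comparison applies to the real and imaginary parts separately, since each is bounded by the
    modulus. *)
Lemma ex_Cseries_abs (a : nat -> C) (b : nat -> R) :
  (forall n, (Cmod (a n) <= b n)%R) -> ex_series b -> exists l : C, is_Cseries a l.
Proof.
  intros Hab Hb.
  assert (Hre : ex_series (fun n => fst (a n))).
  { apply (ex_series_le (V := R_CompleteNormedModule) _ b); [|exact Hb].
    intros n. refine (Rle_trans _ _ _ _ (Hab n)).
    exact (Rle_trans _ _ _ (Rmax_l _ _) (Rmax_Cmod (a n))). }
  assert (Him : ex_series (fun n => snd (a n))).
  { apply (ex_series_le (V := R_CompleteNormedModule) _ b); [|exact Hb].
    intros n. refine (Rle_trans _ _ _ _ (Hab n)).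
    exact (Rle_trans _ _ _ (Rmax_r _ _) (Rmax_Cmod (a n))). }
  destruct Hre as [x Hx], Him as [y Hy]. exists (x, y).
  assert (Hsum : forall n, Csum a n
    = (sum_n (fun k => fst (a k)) n, sum_n (fun k => snd (a k)) n)).
  { induction n as [|n IH].
    - rewrite !sum_O. apply surjective_pairing.
    - rewrite !sum_Sn, IH. reflexivity. }
  apply (filterlim_locally (U := C_UniformSpace)). intros eps.
  generalize (proj1 (filterlim_locally (U := R_UniformSpace) _ _) Hx eps)
    (proj1 (filterlim_locally (U := R_UniformSpace) _ _) Hy eps).
  intros H1 H2. generalize (filter_and _ _ H1 H2). apply filter_imp.
  (* A ball of [C_UniformSpace] is a product of two real balls, so the two componentwise estimates
     are exactly the goal. *)
  intros n Hn. change (ball (M := C_UniformSpace) (x, y) eps (Csum a n)).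
  rewrite Hsum. exact Hn.
Qed.

(** The triangle inequality for partial sums passes to the limit. *)
Lemma Cmod_series_le (a : nat -> C) (b : nat -> R) (la : C) (lb : R) :
  is_Cseries a la -> is_series b lb -> (forall n, (Cmod (a n) <= b n)%R) ->
  (Cmod la <= lb)%R.
Proof.
  intros Ha Hb Hab.
  apply (is_lim_seq_le (fun n => Cmod (Csum a n)) (sum_n b) (Cmod la) lb).
  - intros n. apply (Rle_trans _ (sum_n (fun k => Cmod (a k)) n)).
    + apply (norm_sum_n_m (V := C_NormedModule)).
    + apply sum_n_m_le. exact Hab.
  - exact (filterlim_comp _ _ _ _ _ _ _ _ Ha (filterlim_norm (V := C_NormedModule) la)).
  - exact Hb.
Qed.

Lemma Cmod_series_tail_le (a : nat -> C) (b : nat -> R) (la : C) (lb : R) (n : nat) :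
  is_Cseries a la -> is_series b lb -> (forall n, (Cmod (a n) <= b n)%R) ->
  (Cmod (la - Csum a n) <= lb - sum_n b n)%R.
Proof.
  intros Ha Hb Hab.
  (* [sum_n] includes the index [n], so the remainder starts at [S n]. *)
  apply (Cmod_series_le (fun k => a (S n + k)%nat) (fun k => b (S n + k)%nat)).
  - apply (is_series_incr_n (V := C_NormedModule)); [lia|].
    apply (is_Cseries_congr _ _ _ _ Ha); [reflexivity|].
    change (la = la - Csum a n + Csum a n). ring.
  - apply is_series_incr_n; [lia|].
    replace (plus _ _) with lb; [exact Hb|].
    change (lb = lb - sum_n b n + sum_n b n)%R. ring.
  - intros k. apply Hab.
Qed.

(** * Interchange of summations under a product bound *)

Lemma is_Cseries_sum_n (u : nat -> nat -> C) (K : nat -> C) (M : nat) :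
  (forall m, is_Cseries (fun n => u n m) (K m)) ->
  is_Cseries (fun n => Csum (u n) M) (Csum K M).
Proof.
  intros HK. induction M as [|M IH].
  - apply (is_Cseries_congr _ _ _ _ (HK O)); intros; now rewrite sum_O.
  - apply (is_Cseries_congr _ _ _ _ (is_Cseries_plus _ _ _ _ IH (HK (S M))));
      intros; now rewrite sum_Sn.
Qed.

(** Row sums are dominated by [alpha n * B], so they have a sum [S]. The sum of the columns up to
    [M] then misses [S] by at most [A] times the tail of [beta], which tends to 0. *)
Lemma is_Cseries_exchange (u : nat -> nat -> C) (alpha beta : nat -> R)
    (r c : nat -> C) :
  (forall n m, (Cmod (u n m) <= alpha n * beta m)%R) ->
  ex_series alpha -> ex_series beta ->
  (forall n, is_Cseries (u n) (r n)) ->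
  (forall m, is_Cseries (fun n => u n m) (c m)) ->
  exists S : C, is_Cseries r S /\ is_Cseries c S.
Proof.
  intros Hu [A HA] [B HB] Hr Hc.
  assert (Hb : forall n, is_series (fun m => alpha n * beta m)%R (alpha n * B)%R).
  { intros n. exact (is_series_scal (V := R_NormedModule) (alpha n) beta B HB). }
  assert (Ha : forall x, is_series (fun n => alpha n * x)%R (A * x)%R).
  { intros x. rewrite Rmult_comm.
    apply (is_series_ext (fun n => x * alpha n)%R); [intros; apply Rmult_comm|].
    exact (is_series_scal (V := R_NormedModule) x alpha A HA). }
  destruct (ex_Cseries_abs r (fun n => alpha n * B)%R) as [S HS].
  { intros n. exact (Cmod_series_le _ _ _ _ (Hr n) (Hb n) (Hu n)). }
  { eexists. apply Ha. }
  exists S. split; [exact HS|].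
  assert (Htail : forall M, (Cmod (Csum c M - S) <= A * (B - sum_n beta M))%R).
  { intros M. rewrite <- Cmod_opp.
    (* [S - Csum c M] is itself a series over the rows: its [n]-th term is the tail of row [n]
       beyond [M], of modulus at most [alpha n] times the tail of [beta]. *)
    refine (Cmod_series_le (fun n => r n + -1 * Csum (u n) M) _ _ _ _ (Ha _) _).
    - apply (is_Cseries_congr _ _ _ _ (is_Cseries_plus _ _ _ _ HS
        (is_Cseries_scal (-1) _ _ (is_Cseries_sum_n u c M Hc)))); [reflexivity|ring].
    - intros n. replace (r n + _) with (r n - Csum (u n) M) by ring.
      refine (Rle_trans _ _ _ (Cmod_series_tail_le _ _ _ _ M (Hr n) (Hb n) (Hu n)) _).
      apply Req_le. rewrite (sum_n_mult_l (K := R_Ring)).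
      change (alpha n * B - alpha n * sum_n beta M = alpha n * (B - sum_n beta M))%R.
      ring. }
  apply (filterlim_locally_ball_norm (K := C_AbsRing) (U := C_NormedModule)).
  intros eps.
  assert (Hlim : is_lim_seq (fun M => A * (B - sum_n beta M))%R 0).
  { replace (Finite 0) with (Rbar_mult A (B - B)%R) by (simpl; f_equal; ring).
    apply is_lim_seq_scal_l. apply is_lim_seq_minus'; [apply is_lim_seq_const|exact HB]. }
  generalize (proj1 (filterlim_locally (U := R_UniformSpace) _ _) Hlim eps).
  apply filter_imp. intros M HM.
  change (Rabs (A * (B - sum_n beta M) - 0) < eps)%R in HM.
  change (Cmod (Csum c M - S) < eps)%R.
  generalize (Htail M) (Rle_abs (A * (B - sum_n beta M) - 0)). lra.
Qed.

(** * Power series with bounded coefficients on the unit disc *)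

(* Bounded coefficients suffice for domination on the unit disc, and boundedness
   survives the recurrences below. *)
Definition represents (b : nat -> C) (f : C -> C) : Prop :=
  (exists M : R, forall n, (Cmod (b n) <= M)%R) /\
  (forall z, (Cmod z < 1)%R -> is_Cseries (fun n => b n * z ^ n) (f z)).

Lemma represents_ext (b b' : nat -> C) (f f' : C -> C) :
  represents b f -> (forall n, b n = b' n) ->
  (forall z, (Cmod z < 1)%R -> f z = f' z) -> represents b' f'.
Proof.
  intros [[M HM] Hf] Hb Hff. split.
  - exists M. intros n. rewrite <- Hb. apply HM.
  - intros z Hz. apply (is_Cseries_congr _ _ _ _ (Hf z Hz)); [|now apply Hff].
    intros n. now rewrite Hb.
Qed.

Lemma ex_geom_scal (M x : R) :
  (0 <= x < 1)%R -> ex_series (fun n => M * x ^ n)%R.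
Proof.
  intros Hx. apply (ex_series_scal (V := R_NormedModule) M (fun n => x ^ n)%R).
  apply ex_series_geom. rewrite Rabs_pos_eq; lra.
Qed.

Lemma Cmod_mult_pow_le (b z : C) (n : nat) (M : R) :
  (Cmod b <= M)%R -> (Cmod (b * z ^ n) <= M * Cmod z ^ n)%R.
Proof.
  intros Hb. rewrite Cmod_mult, Cmod_pow.
  apply Rmult_le_compat_r; [apply pow_le, Cmod_ge_0|exact Hb].
Qed.

Lemma ex_pseries_bounded (b : nat -> C) (M : R) (z : C) :
  (forall n, (Cmod (b n) <= M)%R) -> (Cmod z < 1)%R ->
  exists l : C, is_Cseries (fun n => b n * z ^ n) l.
Proof.
  intros Hb Hz. apply (ex_Cseries_abs _ (fun n => M * Cmod z ^ n)%R).
  - intros n. now apply Cmod_mult_pow_le.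
  - apply ex_geom_scal. split; [apply Cmod_ge_0|exact Hz].
Qed.

Lemma is_Cseries_unique (a : nat -> C) (l l' : C) :
  is_Cseries a l -> is_Cseries a l' -> l = l'.
Proof.
  exact (filterlim_locally_unique (K := C_AbsRing) (V := C_NormedModule) _ l l').
Qed.

(** After the constant term, the series of [d] is the tail of the series of [b] minus [sigma * z]
    times the whole series. *)
Lemma is_Cseries_mul_linear (b d : nat -> C) (sigma z l : C) :
  d O = b O -> (forall n, d (S n) = b (S n) - sigma * b n) ->
  is_Cseries (fun n => b n * z ^ n) l ->
  is_Cseries (fun n => d n * z ^ n) ((1 - sigma * z) * l).
Proof.
  intros H0 HS Hl.
  refine (is_Cseries_congr _ _ _ _ (is_Cseries_cons (fun n => d n * z ^ n) _
    (is_Cseries_congr _ _ _ _ (is_Cseries_plus _ _ _ _ (is_Cseries_tl _ _ Hl)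
      (is_Cseries_scal (- (sigma * z)) _ _ Hl)) _ eq_refl)) _ _).
  - intros n. rewrite HS, Cpow_S. ring.
  - reflexivity.
  - rewrite H0. simpl. ring.
Qed.

Lemma represents_mul_linear (b d : nat -> C) (f : C -> C) (sigma : C) :
  d O = b O -> (forall n, d (S n) = b (S n) - sigma * b n) ->
  represents b f -> represents d (fun z => (1 - sigma * z) * f z).
Proof.
  intros H0 HS [[M HM] Hf]. split.
  - exists (M + Cmod sigma * M)%R.
    assert (HM0 : (0 <= M)%R) by exact (Rle_trans _ _ _ (Cmod_ge_0 _) (HM O)).
    assert (Hs := Cmod_ge_0 sigma).
    intros [|n].
    + rewrite H0. generalize (HM O). nra.
    + rewrite HS. unfold Cminus.
      refine (Rle_trans _ _ _ (Cmod_triangle _ _) _).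
      rewrite Cmod_opp, Cmod_mult.
      apply Rplus_le_compat; [apply HM|].
      apply Rmult_le_compat_l; [exact Hs|apply HM].
  - intros z Hz. apply (is_Cseries_mul_linear b); auto.
Qed.

Lemma one_minus_neq0 (x : C) : (Cmod x < 1)%R -> 1 - x <> 0.
Proof.
  intros Hx H. assert (x = 1) as -> by (transitivity (1 - (1 - x)); [ring|rewrite H; ring]).
  rewrite Cmod_1 in Hx. lra.
Qed.

Lemma Cmod_mult_lt1 (x y : C) : (Cmod x <= 1)%R -> (Cmod y < 1)%R -> (Cmod (x * y) < 1)%R.
Proof.
  intros Hx Hy. rewrite Cmod_mult.
  generalize (Cmod_ge_0 x) (Cmod_ge_0 y). nra.
Qed.

(** Once the coefficients [b] are known to be bounded, their series converges; multiplying its sum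
    by [1 - sigma * z] must return [f z], by uniqueness of sums. *)
Lemma represents_div_linear (b d : nat -> C) (f : C -> C) (sigma : C) :
  (Cmod sigma < 1)%R ->
  d O = b O -> (forall n, d (S n) = b (S n) - sigma * b n) ->
  represents d f -> represents b (fun z => f z / (1 - sigma * z)).
Proof.
  intros Hs H0 HS [[M HM] Hf].
  assert (HM0 : (0 <= M)%R) by exact (Rle_trans _ _ _ (Cmod_ge_0 _) (HM O)).
  assert (Hs0 := Cmod_ge_0 sigma).
  (* The fixed point of [x = M + Cmod sigma * x], hence a bound preserved by the recurrence
     [b (S n) = d (S n) + sigma * b n]. *)
  set (M' := (M / (1 - Cmod sigma))%R).
  assert (HM' : (M + Cmod sigma * M' = M')%R) by (unfold M'; field; lra).
  assert (HM'0 : (0 <= M')%R) by (unfold M'; apply Rdiv_le_0_compat; lra).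
  assert (Hb : forall n, (Cmod (b n) <= M')%R).
  { induction n as [|n IH].
    - rewrite <- H0. generalize (HM O). nra.
    - replace (b (S n)) with (d (S n) + sigma * b n) by (rewrite HS; ring).
      refine (Rle_trans _ _ _ (Cmod_triangle _ _) _). rewrite Cmod_mult.
      generalize (HM (S n)). nra. }
  split; [now exists M'|].
  intros z Hz. destruct (ex_pseries_bounded b M' z Hb Hz) as [l Hl].
  apply (is_Cseries_congr _ _ _ _ Hl); [reflexivity|].
  rewrite (is_Cseries_unique _ _ _ (Hf z Hz) (is_Cseries_mul_linear b d sigma z l H0 HS Hl)).
  field. apply one_minus_neq0, Cmod_mult_lt1; lra.
Qed.

Lemma represents_geom : represents (fun _ => 1) (fun z => / (1 - z)).
Proof.
  assert (H1 : forall n : nat, (Cmod 1 <= 1)%R) by (intros; rewrite Cmod_1; lra).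
  split; [now exists 1%R|].
  intros z Hz. destruct (ex_pseries_bounded _ _ z H1 Hz) as [l Hl].
  apply (is_Cseries_congr _ _ _ _ Hl); [reflexivity|].
  (* Deleting the first term and multiplying by [z] give the same series. *)
  assert (E : l - 1 * z ^ 0 = z * l).
  { apply (is_Cseries_unique _ _ _ (is_Cseries_tl _ _ Hl)).
    apply (is_Cseries_congr _ _ _ _ (is_Cseries_scal z _ _ Hl)); [|reflexivity].
    intros n. rewrite Cpow_S. ring. }
  assert (Hz1 := one_minus_neq0 z Hz).
  replace l with (((l - 1 * z ^ 0) - z * l + 1) / (1 - z)) by (simpl; field; exact Hz1).
  rewrite E. field. exact Hz1.
Qed.

(** * Identities and nonvanishing for q-shifted factorials *)

Lemma qpoch_Sl (x q : C) (n : nat) :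
  qpoch x q (S n) = (1 - x) * qpoch (x * q) q n.
Proof.
  induction n as [|n IH].
  - simpl. ring.
  - change (qpoch x q (S n) * (1 - x * q ^ S n)
      = (1 - x) * (qpoch (x * q) q n * (1 - x * q * q ^ n))).
    rewrite IH, Cpow_S. ring.
Qed.

Lemma qpoch_add (x q : C) (n m : nat) :
  qpoch x q (n + m) = qpoch x q n * qpoch (x * q ^ n) q m.
Proof.
  induction m as [|m IH].
  - rewrite Nat.add_0_r. simpl. ring.
  - rewrite Nat.add_succ_r. simpl. rewrite IH, Cpow_add_r. ring.
Qed.

Lemma qpoch_1_S (q : C) (n : nat) : qpoch 1 q (S n) = 0.
Proof. rewrite qpoch_Sl. ring. Qed.

Lemma Cmod_pow_le1 (q : C) (n : nat) : (Cmod q < 1)%R -> (Cmod (q ^ n) <= 1)%R.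
Proof.
  intros Hq. rewrite Cmod_pow, <- (pow1 n).
  apply pow_incr. generalize (Cmod_ge_0 q). lra.
Qed.

Lemma qpoch_neq0 (x q : C) (n : nat) :
  (Cmod q < 1)%R -> (Cmod x < 1)%R -> qpoch x q n <> 0.
Proof.
  intros Hq Hx. induction n as [|n IH]; simpl.
  - exact C1_nz.
  - apply Cmult_neq_0; [exact IH|].
    rewrite Cmult_comm. apply one_minus_neq0, Cmod_mult_lt1; [|exact Hx].
    now apply Cmod_pow_le1.
Qed.

(** * Cauchy products and linear factors *)

Lemma Csum_Sl (a : nat -> C) (n : nat) :
  Csum a (S n) = a O + Csum (fun k => a (S k)) n.
Proof.
  induction n as [|n IH].
  - rewrite sum_Sn, !sum_O. reflexivity.
  - rewrite sum_Sn, IH, sum_Sn. symmetry. apply Cplus_assoc.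
Qed.

Lemma Csum_sub_scal (u v w : nat -> C) (sigma : C) (n : nat) :
  (forall k, w k = u k - sigma * v k) ->
  Csum w n = Csum u n - sigma * Csum v n.
Proof.
  intros H. induction n as [|n IH].
  - rewrite !sum_O. apply H.
  - rewrite !sum_Sn, IH, H. unfold plus; simpl. ring.
Qed.

Definition cauchy_prod (p b : nat -> C) (n : nat) : C :=
  Csum (fun k => p k * b (n - k)%nat) n.

(** Multiplying the left factor by [1 - sigma z] multiplies the whole product by it. Splitting off
    [k = 0] aligns the shifted coefficients of [p] with the product of index [n]. *)
Lemma cauchy_prod_S_linear (p p' b : nat -> C) (sigma : C) (n : nat) :
  p' O = p O -> (forall k, p' (S k) = p (S k) - sigma * p k) ->
  cauchy_prod p' b (S n) = cauchy_prod p b (S n) - sigma * cauchy_prod p b n.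
Proof.
  intros H0 HS. unfold cauchy_prod. rewrite !Csum_Sl, H0.
  rewrite (Csum_sub_scal (fun k => p (S k) * b (S n - S k)%nat)
    (fun k => p k * b (n - k)%nat) _ sigma n).
  - ring.
  - intros k. rewrite HS. simpl. ring.
Qed.

Lemma cauchy_prod_1_l (p b : nat -> C) (n : nat) :
  p O = 1 -> (forall k, p (S k) = 0) -> cauchy_prod p b n = b n.
Proof.
  intros H0 HS. unfold cauchy_prod. destruct n as [|n].
  - rewrite sum_O, H0. simpl. ring.
  - rewrite Csum_Sl, H0.
    rewrite (Csum_sub_scal (fun _ => 0) (fun _ => 0) _ 1 n).
    + simpl. ring.
    + intros k. rewrite HS. ring.
Qed.

(** * Finite q-binomial expansions of numerator and denominator *)

(** These vanish for [k > N], when (q^{-N})_k contains the factor 1 - q^{-N} q^N; the polynomial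
    (sz)_N is thus handled as an infinite coefficient sequence. *)
Definition qnum_coef (q s : C) (N k : nat) : C :=
  qpoch (/ q ^ N) q k * (s * q ^ N) ^ k / qpoch q q k.

Definition qden_coef (q : C) (N k : nat) : C :=
  qpoch (q ^ N) q k / qpoch q q k.

Lemma qpoch_q_S (q : C) (n : nat) : (Cmod q < 1)%R -> 1 - q * q ^ n <> 0.
Proof.
  intros Hq. rewrite Cmult_comm.
  apply one_minus_neq0, Cmod_mult_lt1; [|exact Hq]. now apply Cmod_pow_le1.
Qed.

(** Induction from the geometric series, dividing by [1 - q ^ S N * z] at each step. *)
Lemma represents_qden (q : C) (N : nat) :
  (Cmod q < 1)%R ->
  represents (qden_coef q (S N)) (fun z => / qpoch z q (S N)).
Proof.
  intros Hq. induction N as [|N IH].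
  - apply (represents_ext _ _ _ _ represents_geom).
    + intros n. unfold qden_coef. replace (q ^ 1) with q by (simpl; ring).
      field. now apply qpoch_neq0.
    + intros z Hz. simpl. f_equal. ring.
  - assert (Hlt : (Cmod (q ^ S N) < 1)%R).
    { rewrite Cpow_S, Cmult_comm. apply Cmod_mult_lt1; [now apply Cmod_pow_le1|exact Hq]. }
    refine (represents_ext _ _ _ _
      (represents_div_linear (qden_coef q (S (S N))) _ _ (q ^ S N) Hlt _ _ IH)
      (fun n => eq_refl) _).
    + reflexivity.
    + intros n. unfold qden_coef.
      (* Peeling off the first factor leaves (q^{N+2})_n common to all three coefficients; what
         remains is (1 - q^{N+n+2}) - q^{N+1} (1 - q^{n+1}) = 1 - q^{N+1}. *)
      rewrite (qpoch_Sl (q ^ S N)).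
      replace (q ^ S N * q) with (q ^ S (S N)) by (rewrite (Cpow_S q (S N)); ring).
      simpl.
      field. split; [now apply qpoch_neq0|now apply qpoch_q_S].
    + intros z Hz.
      change (qpoch z q (S (S N))) with (qpoch z q (S N) * (1 - z * q ^ S N)).
      rewrite (Cmult_comm z). field. split.
      * apply one_minus_neq0, Cmod_mult_lt1; lra.
      * now apply qpoch_neq0.
Qed.

(** The coefficient form of (sz)_{N+1} = (1 - s q^N z) (sz)_N; all three terms share the factor
    (q^{-N})_k. *)
Lemma qnum_coef_SS (q s : C) (N k : nat) :
  (Cmod q < 1)%R -> q <> 0 ->
  qnum_coef q s (S N) (S k) = qnum_coef q s N (S k) - s * q ^ N * qnum_coef q s N k.
Proof.
  intros Hq Hq0. unfold qnum_coef.
  assert (HqN := Cpow_nz q N Hq0).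
  rewrite (qpoch_Sl (/ q ^ S N)).
  replace (/ q ^ S N * q) with (/ q ^ N) by (rewrite Cpow_S; field; auto).
  simpl qpoch. rewrite !Cpow_S, !Cpow_mult_l.
  field. repeat split; auto; [now apply qpoch_neq0|now apply qpoch_q_S].
Qed.

(** The two lengths are kept independent so that the induction adds numerator factors over a fixed
    denominator. *)
Lemma represents_qquot (q s : C) (N M : nat) :
  (Cmod q < 1)%R -> q <> 0 ->
  represents (cauchy_prod (qnum_coef q s N) (qden_coef q (S M)))
    (fun z => qpoch (s * z) q N / qpoch z q (S M)).
Proof.
  intros Hq Hq0. induction N as [|N IH].
  - apply (represents_ext _ _ _ _ (represents_qden q M Hq)).
    + intros n. symmetry. apply cauchy_prod_1_l.
      * unfold qnum_coef. simpl. field.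
      (* For [N = 0] every positive-degree coefficient contains (1)_{k+1} = 0. *)
      * intros k. unfold qnum_coef. replace (/ q ^ 0) with (RtoC 1) by (simpl; field).
        rewrite qpoch_1_S. unfold Cdiv. ring.
    + intros z _. unfold Cdiv. simpl. ring.
  - refine (represents_ext _ _ _ _ (represents_mul_linear _ _ _ (s * q ^ N) _ _ IH)
      (fun n => eq_refl) _).
    + unfold cauchy_prod. rewrite !sum_O. unfold qnum_coef. simpl. reflexivity.
    + intros n. apply cauchy_prod_S_linear.
      * reflexivity.
      * intros k. now apply qnum_coef_SS.
    + intros z _. simpl. unfold Cdiv. ring.
Qed.

(** For x = a and x = t, (x)_{N+n} splits in two ways: (x)_N (xq^N)_n = (x)_n (xq^n)_N. *)
Lemma qpoch_ratio (a t q : C) (N n : nat) :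
  (forall k, qpoch a q k <> 0) -> (Cmod q < 1)%R -> (Cmod t < 1)%R ->
  qpoch (a * q ^ N) q n / qpoch (t * q ^ N) q n * (qpoch t q n / qpoch a q n)
    - qpoch t q N / qpoch a q N
  = qpoch t q N / qpoch a q N
    * (qpoch (a * q ^ n) q N / qpoch (t * q ^ n) q N - 1).
Proof.
  intros Ha Hq Ht.
  assert (Hsym : forall x, qpoch x q N * qpoch (x * q ^ N) q n
                   = qpoch x q n * qpoch (x * q ^ n) q N).
  { intros x. now rewrite <- !qpoch_add, Nat.add_comm. }
  assert (Htq : forall k, (Cmod (t * q ^ k) < 1)%R).
  { intros k. rewrite Cmult_comm. apply Cmod_mult_lt1; [now apply Cmod_pow_le1|exact Ht]. }
  assert (HtN := qpoch_neq0 _ _ N Hq Ht). assert (Htn := qpoch_neq0 _ _ n Hq Ht).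
  assert (HtNn := qpoch_neq0 _ _ n Hq (Htq N)).
  assert (HtnN := qpoch_neq0 _ _ N Hq (Htq n)).
  assert (Ea : qpoch (a * q ^ N) q n
    = qpoch a q n * qpoch (a * q ^ n) q N / qpoch a q N).
  { rewrite <- Hsym. field. apply Ha. }
  assert (Et : qpoch (t * q ^ N) q n
    = qpoch t q n * qpoch (t * q ^ n) q N / qpoch t q N).
  { rewrite <- Hsym. field. exact HtN. }
  rewrite Ea, Et. field. repeat split; auto.
Qed.

(** * Interchange along the points [q ^ S m] *)

Lemma is_Cseries_of_pseries (a : nat -> C) (x l : C) :
  is_pseries (K := C_AbsRing) (V := C_NormedModule) a x l ->
  is_Cseries (fun n => a n * x ^ n) l.
Proof.
  intros H. apply (is_Cseries_congr _ _ _ _ H); [|reflexivity].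
  intros n. apply Cmult_comm.
Qed.

Lemma ex_pseries_of_Cseries (a : nat -> C) (x : C) :
  (exists l : C, is_Cseries (fun n => a n * x ^ n) l) ->
  ex_pseries (K := C_AbsRing) (V := C_NormedModule) a x.
Proof.
  intros [l H]. exists l. apply (is_Cseries_congr _ _ _ _ H); [|reflexivity].
  intros n. apply Cmult_comm.
Qed.

(** Each term is a difference of consecutive partial sums, and these are bounded; hence the bound
    [M + M]. *)
Lemma is_Cseries_bounded (a : nat -> C) (l : C) :
  is_Cseries a l -> exists M : R, forall n, (Cmod (a n) <= M)%R.
Proof.
  intros H.
  assert (Hb : forall l' : C, is_Cseries a l' ->
    {M : R | forall n, (Cmod (Csum a n) <= M)%R}).
  { intros l' Hl'. apply (filterlim_bounded (V := C_NormedModule)). now exists l'. }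
  destruct (Hb l H) as [M HM]. exists (M + M)%R.
  assert (HM0 : (0 <= M)%R) by exact (Rle_trans _ _ _ (Cmod_ge_0 _) (HM O)).
  intros [|n].
  - generalize (HM O). rewrite sum_O. lra.
  - assert (E : a (S n) = Csum a (S n) + - Csum a n).
    { rewrite sum_Sn. unfold plus; simpl. ring. }
    rewrite E. refine (Rle_trans _ _ _ (Cmod_triangle _ _) _).
    rewrite Cmod_opp. apply Rplus_le_compat; apply HM.
Qed.

(* The column [m = 1] may converge only conditionally, when [q] lies on the
   circle of convergence of [g]; all later columns are dominated by a
   geometric double series. *)
Lemma is_Cseries_exchange_pow (gc c : nat -> C) (g f : C -> C) (q t : C) :
  (Cmod q < 1)%R -> (Cmod t < 1)%R -> represents c f ->
  (forall m, is_Cseries (fun n => gc n * (q ^ S m) ^ n) (g (q ^ S m))) ->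
  exists S1 : C,
    is_Cseries (fun m => c (S m) * g (q ^ S m) * t ^ S m) S1 /\
    is_Cseries (fun n => gc n * (f (t * q ^ n) - c O)) S1.
Proof.
  intros Hq Ht [[K HK] Hf] Hg.
  destruct (is_Cseries_bounded _ _ (Hg O)) as [M HM].
  assert (Htq : forall n, (Cmod (t * q ^ n) < 1)%R).
  { intros n. rewrite Cmult_comm. apply Cmod_mult_lt1; [now apply Cmod_pow_le1|exact Ht]. }
  assert (HK0 : (0 <= K)%R) by exact (Rle_trans _ _ _ (Cmod_ge_0 _) (HK O)).
  assert (HM0 : (0 <= M)%R) by exact (Rle_trans _ _ _ (Cmod_ge_0 _) (HM O)).
  (* Only the columns of index at least 2 are exchanged here; those of index 0 and 1 are removed
     from [f]. *)
  destruct (is_Cseries_exchange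
    (fun n m => gc n * (c (S (S m)) * (t * q ^ n) ^ S (S m)))
    (fun n => M * Cmod q ^ n)%R (fun m => K * Cmod t ^ m)%R
    (fun n => gc n * (f (t * q ^ n) - c O * (t * q ^ n) ^ 0 - c 1%nat * (t * q ^ n) ^ 1))
    (fun m => c (S (S m)) * t ^ S (S m) * g (q ^ S (S m))))
    as [S2 [HR HC]].
  - intros n m.
    (* Of the two guaranteed powers of [q ^ n], one keeps [gc n] bounded by [M] and the other
       supplies geometric decay in [n]. Decay in [m] comes from [t ^ m], and the last factor has
       modulus at most 1. *)
    replace (gc n * _) with
      ((gc n * (q ^ 1) ^ n) * q ^ n * ((c (S (S m)) * t ^ m) * (t ^ 2 * (q ^ n) ^ m))).
    2:{ rewrite (Cpow_1_r q), Cpow_mult_l, !Cpow_S. simpl. ring. }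
    rewrite (Cmod_mult (_ * q ^ n)).
    apply Rmult_le_compat; try apply Cmod_ge_0.
    + apply Cmod_mult_pow_le. apply HM.
    + rewrite Cmod_mult, <- (Rmult_1_r (K * _)).
      apply Rmult_le_compat; try apply Cmod_ge_0.
      * apply Cmod_mult_pow_le. apply HK.
      * rewrite Cmod_mult, <- (Rmult_1_r 1%R).
        apply Rmult_le_compat; try apply Cmod_ge_0.
        -- now apply Cmod_pow_le1.
        -- rewrite <- Cpow_mult_r. now apply Cmod_pow_le1.
  - apply ex_geom_scal. split; [apply Cmod_ge_0|exact Hq].
  - apply ex_geom_scal. split; [apply Cmod_ge_0|exact Ht].
  - intros n. apply is_Cseries_scal.
    exact (is_Cseries_tl _ _ (is_Cseries_tl _ _ (Hf _ (Htq n)))).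
  - intros m.
    apply (is_Cseries_congr _ _ _ _ (is_Cseries_scal (c (S (S m)) * t ^ S (S m)) _ _
      (Hg (S m)))); [|reflexivity].
    intros n. rewrite Cpow_mult_l, <- !Cpow_mult_r, (Nat.mul_comm n). ring.
  (* The column of index 1 is restored: as the first term of the series over [m], and as one
     convergent series added to the series over [n]. *)
  - exists (c 1%nat * g (q ^ 1) * t ^ 1 + S2). split.
    + apply (is_Cseries_cons (fun m => c (S m) * g (q ^ S m) * t ^ S m)).
      apply (is_Cseries_congr _ _ _ _ HC); [|reflexivity].
      intros m. ring.
    + apply (is_Cseries_congr _ _ _ _ (is_Cseries_plus _ _ _ _
        (is_Cseries_scal (c 1%nat * t) _ _ (Hg O)) HR)).
      * intros n. simpl. rewrite Cmult_1_r. ring.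
      * simpl. ring.
Qed.

(** The witness [S] expresses convergence of the right-hand series. The total function [g] is tied
    by [hg] to the power series wherever it converges, and [hcv] yields convergence at every
    positive power of [q]. *)
Theorem theorem1p1 (N : nat) (a t q : C) (gc : nat -> C) (g : C -> C)
  (hN : (1 <= N)%nat)
  (hq : (Cmod q < 1)%R) (ht : (Cmod t < 1)%R)
  (hq0 : q <> 0) (ht0 : t <> 0)
  (ha : forall n : nat, qpoch a q n <> 0)
  (hg : forall x : C,
      ex_pseries (K := C_AbsRing) (V := C_NormedModule) gc x ->
      is_pseries (K := C_AbsRing) (V := C_NormedModule) gc x (g x))
  (hcv : ex_pseries (K := C_AbsRing) (V := C_NormedModule) gc q) :
  exists S : C,
    is_series (K := C_AbsRing) (V := C_NormedModule)
      (fun m : nat =>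
         let n := (m + 1)%nat in
         sum_n (G := C_AbelianGroup)
           (fun k : nat =>
              qbinom q n k * (a * q ^ N / t) ^ k
              * qpoch (/ q ^ N) q k * qpoch (q ^ N) q (n - k)) n
         * (g (q ^ n) / qpoch q q n) * t ^ n) S
    /\
    is_series (K := C_AbsRing) (V := C_NormedModule)
      (fun n : nat =>
         gc n * (qpoch (a * q ^ N) q n / qpoch (t * q ^ N) q n
                 * (qpoch t q n / qpoch a q n)
                 - qpoch t q N / qpoch a q N))
      (qpoch t q N / qpoch a q N * S).
Proof.
  destruct N as [|N]; [lia|].
  set (c := cauchy_prod (qnum_coef q (a / t) (S N)) (qden_coef q (S N))).
  assert (Hc : represents c
    (fun z => qpoch (a / t * z) q (S N) / qpoch z q (S N))) by now apply represents_qquot.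
  assert (Hgq : is_Cseries (fun n => gc n * q ^ n) (g q)).
  { apply is_Cseries_of_pseries, hg, hcv. }
  destruct (is_Cseries_bounded _ _ Hgq) as [M HM].
  assert (Hg : forall m, is_Cseries (fun n => gc n * (q ^ S m) ^ n) (g (q ^ S m))).
  { intros [|m].
    - replace (q ^ 1) with q by (simpl; ring). exact Hgq.
    (* The terms [gc n * q ^ n] are bounded, so taken as coefficients they give a series convergent
       at [q ^ S m], which is the series of [gc] at [q ^ S (S m)]. *)
    - apply is_Cseries_of_pseries, hg, ex_pseries_of_Cseries.
      destruct (ex_pseries_bounded (fun n => gc n * q ^ n) M (q ^ S m)) as [l Hl].
      + exact HM.
      + rewrite Cpow_S, Cmult_comm. apply Cmod_mult_lt1; [now apply Cmod_pow_le1|exact hq].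
      + exists l. apply (is_Cseries_congr _ _ _ _ Hl); [|reflexivity].
        intros n. rewrite (Cpow_S q (S m)), Cpow_mult_l. ring. }
  destruct (is_Cseries_exchange_pow gc c g _ q t hq ht Hc Hg) as [S1 [HS1 HS2]].
  assert (Hc0 : c O = 1).
  { unfold c, cauchy_prod, qnum_coef, qden_coef. rewrite sum_O. simpl. field. }
  exists S1. split.
  - apply (is_Cseries_congr _ _ _ _ HS1); [|reflexivity].
    intros m. rewrite Nat.add_1_r. cbv zeta.
    assert (Hq := fun k => qpoch_neq0 q q k hq hq).
    (* The factor (q)_n turns 1 / ((q)_k (q)_{n-k}) in the Cauchy product into the Gaussian
       binomial. *)
    match goal with |- _ = ?s * _ * _ => assert (E : s = qpoch q q (S m) * c (S m)) end.
    { unfold c, cauchy_prod.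
      rewrite <- (sum_n_mult_l (K := C_Ring) (qpoch q q (S m))).
      apply sum_n_ext. intros k. change mult with Cmult.
      unfold qbinom, qnum_coef, qden_coef.
      replace (a * q ^ S N / t) with (a / t * q ^ S N) by (unfold Cdiv; ring).
      (* With these made opaque, only (q)_k and (q)_{n-k} remain as denominators. *)
      generalize ((a / t * q ^ S N) ^ k) (/ q ^ S N). intros x y.
      match goal with |- ?u = ?v => change (@eq C u v) end.
      field. split; apply Hq. }
    rewrite E. field. apply Hq.
  - apply (is_Cseries_congr _ _ _ _
      (is_Cseries_scal (qpoch t q (S N) / qpoch a q (S N)) _ _ HS2)); [|reflexivity].
    intros n. rewrite qpoch_ratio by assumption. rewrite Hc0.
    (* At z = t q^n the numerator argument sz becomes a q^n, and [c O = 1] is the subtracted 1 in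
       [qpoch_ratio]. *)
    replace (a / t * (t * q ^ n)) with (a * q ^ n) by (field; exact ht0).
    ring.
Qed.
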